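(* Let $G$ be a finite connected graph (loops and multiple edges allowed) and let $\alpha(G)$ denote the number of Eulerian equivalence classes of $\mathcal{BO}(G)$. Then $$\alpha(G)=T_G(0,1),$$ where $T_G(x,y)$ is the Tutte polynomial of $G$. Equivalently, $\alpha(G)$ equals the number of spanning trees of $G$ having no internally active edge with respect to any fixed total order on $E(G)$.
   Context: An orientation of $G=(V,E)$ assigns a direction to each edge. For a partition $V=S\sqcup T$ with $S,T\neq\emptyset$, $[S,T]$ denotes the set of edges joining $S$ and $T$ (a cut); a bond is a minimal nonempty cut. For an orientation $\varepsilon$, $(S,T)_\varepsilon$ is the set of edges of $[S,T]$ directed from $S$ to $T$. A bond $[S,T]$ is directed (relative to $\varepsilon$) if $(S,T)_\varepsilon=\emptyset$ or $(T,S)_\varepsilon=\emptyset$; a cut is directed if it is a disjoint union of directed bonds. $\mathcal{BO}(G)$ is the set of orientations of $G$ having no (nonempty) directed cut; for connected $G$ these are exactly the totally cyclic orientations (every edge lies on a directed cycle). Two orientations $\varepsilon_1,\varepsilon_2$ are Eulerian equivalent if the spanning subgraph formed by the edges $\{e:\varepsilon_1(e)\neq\varepsilon_2(e)\}$, oriented by $\varepsilon_1$, has in-degree equal to out-degree at every vertex. The Tutte polynomial is defined by $T_{E_n}=1$ for the edgeless graph $E_n$, $T_G=xT_{G/e}$ if $e$ is a bridge, $T_G=yT_{G-e}$ if $e$ is a loop, and $T_G=T_{G-e}+T_{G/e}$ otherwise. Given a total order on $E$ and a spanning tree $F$, an edge $f\in F$ is internally active if it is the smallest edge of the cut $\{e\in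 E: (F-f)+e \text{ is a spanning tree}\}$; one has $T_G(x,y)=\sum_{i,j}t_{ij}x^iy^j$ where $t_{ij}$ is the number of spanning trees with exactly $i$ internally active and $j$ externally active edges. *)

(* Defs.v *)
From HB Require Import structures.
From mathcomp Require Import all_boot all_order all_algebra.
Set Implicit Arguments. Unset Strict Implicit. Unset Printing Implicit Defensive.
Import GRing.Theory.

(* A finite multigraph (loops and parallel edges allowed): vertex type, edge
   type, and for each edge its pair of endpoints (a reference labelling,
   used only to describe orientations). *)
Record graph := Graph { gV : finType; gE : finType; gends : gE -> gV * gV }.

Section Graphs.
Variable G : graph.
Local Notation V := (gV G).
Local Notation E := (gE G).
Local Notation src e := (gends e).1.
Local Notation tgt e := (gends e).2.

Definition adjS (F : {set E}) : rel V :=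
  fun u v => [exists e in F, (gends e == (u, v)) || (gends e == (v, u))].

Definition connectsAll (F : {set E}) : bool :=
  [forall u, forall v, connect (adjS F) u v].

Definition gconnected : bool := connectsAll setT.

Definition is_loop (e : E) : bool := src e == tgt e.

Definition is_bridge (e : E) : bool :=
  ~~ connect (adjS (setT :\ e)) (src e) (tgt e).

(* eps e = true : e directed src -> tgt ; false : tgt -> src *)
Definition orientation := {ffun E -> bool}.
Definition tail (eps : orientation) (e : E) : V := if eps e then src e else tgt e.
Definition head (eps : orientation) (e : E) : V := if eps e then tgt e else src e.

Definition cutset (S : {set V}) : {set E} :=
  [set e | (src e \in S) != (tgt e \in S)].

Definition proper_side (S : {set V}) : bool := (S != set0) && (S != setT).

Definition is_cut (C : {set E}) : bool :=
  [exists S : {set V}, proper_side S && (C == cutset S)].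

Definition is_bond (C : {set E}) : bool :=
  [&& is_cut C, C != set0 &
      [forall D : {set E}, (is_cut D && (D != set0) && (D \subset C)) ==> (D == C)]].

Definition dir_from (eps : orientation) (S : {set V}) : {set E} :=
  [set e in cutset S | (tail eps e \in S) && (head eps e \notin S)].

Definition directed_bond (eps : orientation) (C : {set E}) : bool :=
  is_bond C &&
  [exists S : {set V}, [&& proper_side S, C == cutset S &
       (dir_from eps S == set0) || (dir_from eps (~: S) == set0)]].

Definition directed_cut (eps : orientation) (C : {set E}) : bool :=
  is_cut C &&
  [exists P : {set {set E}},
     [&& trivIset P, [forall B in P, directed_bond eps B] & cover P == C]].

Definition BO : {set orientation} :=
  [set eps | [forall C : {set E}, (C != set0) ==> ~~ directed_cut eps C]].

Definition eul_equiv (e1 e2 : orientation) : bool :=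
  let D := [set e | e1 e != e2 e] in
  [forall v, #|[set e in D | head e1 e == v]| == #|[set e in D | tail e1 e == v]|].

Definition alpha : nat :=
  #|[set [set e2 in BO | eul_equiv e1 e2] | e1 in BO]|.

Definition spanning_tree (F : {set E}) : bool :=
  connectsAll F && [forall f in F, ~~ connectsAll (F :\ f)].

Definition fund_cut (F : {set E}) (f : E) : {set E} :=
  [set e | spanning_tree ((F :\ f) :|: [set e])].

(* total order on E given by an injective ranking r *)
Definition int_active (r : E -> nat) (F : {set E}) (f : E) : bool :=
  (f \in F) && [forall e in fund_cut F f, r f <= r e].

Definition trees_no_int_active (r : E -> nat) : nat :=
  #|[set F : {set E} | spanning_tree F && [forall f in F, ~~ int_active r F f]]|.

End Graphs.

Definition del (G : graph) (e : gE G) : graph :=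
  @Graph (gV G) {f : gE G | f != e} (fun f => gends (val f)).

Lemma contr_map_proof (G : graph) (e : gE G)
    (H : (gends e).1 != (gends e).2) (w : gV G) :
  (if w == (gends e).2 then (gends e).1 else w) != (gends e).2.
Proof. case E: (w == (gends e).2). by []. by rewrite E. Qed.

Definition contr_vmap (G : graph) (e : gE G)
    (H : (gends e).1 != (gends e).2) (w : gV G) : {w : gV G | w != (gends e).2} :=
  exist (fun x : gV G => x != (gends e).2) _ (contr_map_proof H w).

Definition contr (G : graph) (e : gE G) (H : (gends e).1 != (gends e).2) : graph :=
  @Graph {w : gV G | w != (gends e).2} {f : gE G | f != e}
    (fun f => (contr_vmap H (gends (val f)).1, contr_vmap H (gends (val f)).2)).

(* Tutte polynomial via deletion-contraction, as a relation.
   Bivariate polynomials over int: outer variable x = 'X,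
   inner variable y = ('X : {poly int})%:P. *)
Definition tx : {poly {poly int}} := 'X.
Definition ty : {poly {poly int}} := ('X : {poly int})%:P.

Inductive tutte : graph -> {poly {poly int}} -> Prop :=
| tutte_edgeless G : #|gE G| = 0 -> tutte G 1
| tutte_bridge G (e : gE G) (H : (gends e).1 != (gends e).2) p :
    is_bridge e -> tutte (contr H) p -> tutte G (tx * p)
| tutte_loop G (e : gE G) p : is_loop e -> tutte (del e) p -> tutte G (ty * p)
| tutte_other G (e : gE G) (H : (gends e).1 != (gends e).2) p q :
    ~~ is_bridge e -> tutte (del e) p -> tutte (contr H) q -> tutte G (p + q).

Definition eval2 (T : {poly {poly int}}) (a b : int) : int := (T.[a%:P]).[b].

(* Main.v *)
Require Import Defs.
From HB Require Import structures.
From mathcomp Require Import all_boot all_order all_algebra zify finmap.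
Set Implicit Arguments. Unset Strict Implicit. Unset Printing Implicit Defensive.

(** Two orientations are Eulerian equivalent iff they have the same outdegrees, and an
    orientation lies in [BO G] iff every vertex set with a nonempty cut has an outgoing
    edge.  With Hakimi's theorem this makes [alpha G] the number of [d : V -> nat] whose
    sum is [#|E|] and whose sum over every [S] is at least the number of edges inside
    [S], plus one if the cut of [S] is nonempty.  Let [e] be an edge with ends [u], [v]
    that is not a bridge.  The sequences without a tight set containing [u] but not [v]
    come from those of [G - e] by adding [1] at [u].  The other ones have the least
    possible value at [u] for given sum of the values at [u] and [v], so they correspond
    to the sequences of [G / e]; uncrossing tight sets shows that this least value is
    attained.  So [alpha] obeys the recursion of [T(0, 1)].

    The trees without internally active edge obey it as well when the largest edge is
    deleted and contracted: the fundamental cut of [f] in a tree [F] is the only cut that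
    meets [F] in [f] alone, and the largest edge matters to no minimum over such a cut
    but its own. *)

(* [seq.head] would otherwise shadow the head of an edge. *)
Local Notation head := Defs.head.
Local Notation src e := (gends e).1.
Local Notation tgt e := (gends e).2.

Section SymmetricDifference.
Variable T : finType.
Implicit Types (A B C : {set T}).

Definition symdiff A B : {set T} := [set x | (x \in A) (+) (x \in B)].

Lemma symdiffvv A : symdiff A A = set0.
Proof. by apply/setP => x; rewrite !inE addbb. Qed.

Lemma symdiffIl A B C : symdiff A B :&: C = symdiff (A :&: C) (B :&: C).
Proof. by apply/setP => x; rewrite !inE andb_addl. Qed.

End SymmetricDifference.

Lemma imset_preimsetI (aT rT : finType) (h : aT -> rT) (A : {set aT}) (C : {set rT}) :
  h @: (h @^-1: C :&: A) = C :&: h @: A.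
Proof.
apply/setP => y; apply/imsetP/setIP => [[x /setIP[]] + xA ->|[yC /imsetP[x xA yx]]].
  by rewrite inE imset_f.
by exists x; rewrite // !inE -yx yC.
Qed.

Lemma forall_in_imset (aT rT : finType) (h : aT -> rT) (A : {set aT}) (P : pred rT) :
  [forall y in h @: A, P y] = [forall x in A, P (h x)].
Proof.
apply/forall_inP/forall_inP => PA x; first by move=> xA; rewrite PA ?imset_f.
by case/imsetP => y /PA + ->.
Qed.

Section RemovedPoint.
Variables (T : finType) (a : T).
Implicit Types (A : {set {x | x != a}}) (B : {set T}).

Lemma notin_imset_val A : a \notin val @: A.
Proof. by apply/imsetP => -[x _ ax]; have := valP x; rewrite -ax eqxx. Qed.

Lemma imset_val_surj B : a \notin B -> exists A, B = val @: A.
Proof.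
move=> aB; exists [set x | val x \in B]; apply/setP => x.
apply/idP/imsetP => [xB|[y]]; last by rewrite inE => yB ->.
have xa : x != a by apply: contraNneq aB => <-.
by exists (exist _ x xa); rewrite ?inE.
Qed.

Lemma cardsD1_sub (P : pred T) :
  #|[set x | P x]| = #|[set x : {x | x != a} | P (val x)]| + P a.
Proof.
rewrite (cardsD1 a) inE addnC; congr (_ + _).
rewrite -(card_imset _ val_inj); apply: eq_card => x; rewrite !inE.
apply/andP/imsetP => [[xa Px]|[[y ya]]]; last by rewrite inE => Py ->.
by exists (exist _ x xa); rewrite ?inE.
Qed.

End RemovedPoint.

Lemma card_preim_partition (T : finType) (Y : choiceType) (f : T -> Y) (D : {set T}) :
  #|preim_partition f D| = #|` [fset f x | x in D]%fset|.
Proof.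
pose fib y := [set x in D | y == f x].
have fib_inj : {in [fset f x | x in D]%fset &, injective fib}.
  move=> _ y /imfsetP[/= x xD ->] _ /setP/(_ x).
  by rewrite !inE xD eqxx => /esym/eqP.
transitivity #|` (fib @` [fset f x | x in D])%fset|; last by rewrite card_in_imfset.
rewrite -card_finset; congr #|` _|; apply/fsetP => C; rewrite in_fset.
apply/imsetP/imfsetP => /= [[x xD ->]|[y]].
  by exists (f x); rewrite ?in_imfset.
by case/imfsetP => /= x xD -> ->; exists x.
Qed.

Section VertexSums.
Variable V : finType.
Implicit Types (S T : {set V}) (d : {ffun V -> nat}) (x : V).

Lemma sum_setUI S T (F : V -> nat) :
  \sum_(v in S :|: T) F v + \sum_(v in S :&: T) F v =
  \sum_(v in S) F v + \sum_(v in T) F v.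
Proof.
rewrite !(big_mkcond (fun v => v \in _)) -!big_split /=; apply: eq_bigr => v _.
by rewrite !inE; case: (v \in S); case: (v \in T); rewrite ?addn0.
Qed.

Lemma sum_eq_op S x : \sum_(v in S) (v == x) = (x \in S).
Proof.
have [xS|xS] := boolP (x \in S).
  by rewrite (big_setD1 x) //= eqxx big1 // => v; rewrite !inE => /andP[/negbTE->].
by rewrite big1 // => v vS; case: eqP vS => // ->; rewrite (negbTE xS).
Qed.

Definition incr x d : {ffun V -> nat} := [ffun v => d v + (v == x)].

Lemma incr_inj x : injective (incr x).
Proof.
by move=> d1 d2 /ffunP eq_d; apply/ffunP => v; move: (eq_d v); rewrite !ffunE => /addIn.
Qed.

Lemma incr_surj x d : 0 < d x -> exists d0, d = incr x d0.
Proof.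
move=> dx; exists [ffun v => d v - (v == x)]; apply/ffunP => v; rewrite !ffunE.
by have [->|] := eqVneq v x; rewrite ?subnK ?subn0 ?addn0.
Qed.

Lemma sum_incr S x d : \sum_(v in S) incr x d v = \sum_(v in S) d v + (x \in S).
Proof. by under eq_bigr do rewrite ffunE; rewrite big_split sum_eq_op. Qed.

End VertexSums.

Section Cuts.
Variable G : graph.
Local Notation V := (gV G).
Local Notation E := (gE G).
Implicit Types (S T : {set V}) (F : {set E}) (e f g : E) (x y : V).

Definition joins e x y := (gends e == (x, y)) || (gends e == (y, x)).

Lemma joins_sym e x y : joins e x y = joins e y x.
Proof. exact: orbC. Qed.

Lemma joins_ends e : joins e (src e) (tgt e).
Proof. by rewrite /joins -surjective_pairing eqxx. Qed.

Lemma cutset_symdiff S T : cutset (symdiff S T) = symdiff (cutset S) (cutset T).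
Proof.
apply/setP => f; rewrite !inE.
by do 2![case: (src f \in _)]; do 2![case: (tgt f \in _)].
Qed.

Lemma cutset0 : cutset (set0 : {set V}) = set0.
Proof. by apply/setP => f; rewrite !inE. Qed.

Lemma cutsetC S : cutset (~: S) = cutset S.
Proof. by apply/setP => f; rewrite !inE; case: (_ \in S); case: (_ \in S). Qed.

Lemma cutsetI_sub S T : cutset (S :&: T) \subset cutset S :|: cutset T.
Proof.
apply/subsetP => f; rewrite !inE.
by do 2![case: (src f \in _)]; do 2![case: (tgt f \in _)].
Qed.

Lemma cutsetU_sub S T : cutset (S :|: T) \subset cutset S :|: cutset T.
Proof.
apply/subsetP => f; rewrite !inE.
by do 2![case: (src f \in _)]; do 2![case: (tgt f \in _)].
Qed.

Lemma loop_notin_cutset e S : is_loop e -> e \notin cutset S.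
Proof. by rewrite inE => /eqP->; rewrite eqxx. Qed.

Lemma cutset_separates e S : e \in cutset S ->
  exists T, [/\ src e \in T, tgt e \notin T & cutset T = cutset S].
Proof.
rewrite inE; case sS: (src e \in S); case tS: (tgt e \in S) => // _.
  by exists S; rewrite sS tS.
by exists (~: S); rewrite cutsetC !inE sS tS.
Qed.

Lemma proper_sideP S :
  reflect (exists x y, x \in S /\ y \notin S) (proper_side S).
Proof.
apply: (iffP andP) => [[/set0Pn[x xS]]|[x [y [xS yS]]]].
  by rewrite -subTset => /subsetPn[y _ yS]; exists x, y.
split; first by apply/set0Pn; exists x.
by apply: contraNneq yS => ->; rewrite inE.
Qed.

Lemma cutset_proper e S : e \in cutset S -> proper_side S.
Proof.
rewrite inE => eS; apply/proper_sideP; move: eS.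
case sS: (src e \in S); case tS: (tgt e \in S) => // _.
  by exists (src e), (tgt e); rewrite sS tS.
by exists (tgt e), (src e); rewrite sS tS.
Qed.

Lemma connect_cutPn F x y :
  reflect (exists S, [/\ x \in S, y \notin S & cutset S :&: F = set0])
          (~~ connect (adjS F) x y).
Proof.
apply: (iffP idP) => [xy|[S [xS yS SF]]].
  exists [set z | connect (adjS F) x z]; rewrite !inE connect0; split => //.
  apply/setP => f; rewrite !inE; apply/negP => /andP[xf fF]; case/negP: xf.
  have adj : adjS F (src f) (tgt f).
    by apply/exists_inP; exists f; rewrite // [_ || _]joins_ends.
  have jda : adjS F (tgt f) (src f).
    by apply/exists_inP; exists f; rewrite // [_ || _]joins_sym joins_ends.
  by apply/eqP; apply/idP/idP => /connect_trans; apply; apply: connect1.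
apply: contra yS => /connectP[p pth ->].
elim: p x xS pth => [|z p IH] x xS //= /andP[/exists_inP[f fF xzf]]; apply: IH.
move/setP/(_ f): SF; rewrite !inE fF andbT => /negbFE.
by case/orP: xzf => /eqP-> /=; rewrite xS => /eqP.
Qed.

Lemma connectsAllPn F :
  reflect (exists2 S, proper_side S & cutset S :&: F = set0)
          (~~ connectsAll F).
Proof.
apply: (iffP idP) => [|[S /proper_sideP[x [y [xS yS]]] SF]].
  case/forallPn => x /forallPn[y /connect_cutPn[S [xS yS SF]]].
  by exists S => //; apply/proper_sideP; exists x, y.
apply/forallPn; exists x; apply/forallPn; exists y.
by apply/connect_cutPn; exists S.
Qed.

Lemma connectsAllP F :
  reflect (forall S, proper_side S -> cutset S :&: F != set0) (connectsAll F).
Proof.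
apply: (iffP idP) => [cF S pS|meetF].
  by apply: contraL cF => /eqP SF; apply/connectsAllPn; exists S.
by apply: contraT => /connectsAllPn[S /meetF + SF]; rewrite SF eqxx.
Qed.

Lemma bridgeP e : reflect (exists S, cutset S = [set e]) (is_bridge e).
Proof.
apply: (iffP (connect_cutPn _ _ _)) => [[S [sS tS Se]]|[S Se]].
  exists S; apply/setP => f; move/setP/(_ f): Se; rewrite !inE.
  by have [->|_] := eqVneq f e; rewrite ?sS ?(negbTE tS) ?andbT.
have [|T [sT tT TS]] := @cutset_separates e S; first by rewrite Se set11.
exists T; split=> //; rewrite TS Se; apply/setP => f; rewrite !inE.
by rewrite andbT andbN.
Qed.

Lemma loop_nonbridge e : is_loop e -> ~~ is_bridge e.
Proof.
move=> lp; apply/bridgeP => -[S Se].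
by have := loop_notin_cutset S lp; rewrite Se set11.
Qed.

Lemma nonbridge_cutset e S : ~~ is_bridge e -> e \in cutset S ->
  exists2 g, g != e & g \in cutset S.
Proof.
move=> nbr eS; have /set0Pn[g] : cutset S :\ e != set0.
  apply: contraNneq nbr => Se; apply/bridgeP; exists S.
  by rewrite -(setD1K eS) Se setU0.
by rewrite !inE => /andP[ge gS]; exists g; rewrite // inE.
Qed.

End Cuts.

Section OutClosed.
Variable G : graph.
Local Notation V := (gV G).
Local Notation E := (gE G).
Implicit Types (S T : {set V}) (C : {set E}) (e f g : E) (eps : orientation G).

Lemma in_dir_from eps S f :
  (f \in dir_from eps S) = (tail eps f \in S) && (head eps f \notin S).
Proof.
rewrite !inE /tail /head.
by case: (eps f); case: (_ \in S); case: (_ \in S).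
Qed.

Lemma in_cutset_orient eps S f :
  (f \in cutset S) = ((tail eps f \in S) != (head eps f \in S)).
Proof. by rewrite inE /tail /head; case: (eps f) => //; rewrite eq_sym. Qed.

Definition out_closed eps S := dir_from eps S == set0.

Lemma out_closedP eps S :
  reflect (forall f, tail eps f \in S -> head eps f \in S) (out_closed eps S).
Proof.
apply: (iffP eqP) => [S0 f tS|clS].
  by move/setP/(_ f): S0; rewrite in_dir_from tS inE => /negbFE.
by apply/setP => f; rewrite in_dir_from inE; apply/andP => -[/clS->].
Qed.

Lemma in_cutset_out_closed eps S f : out_closed eps S ->
  (f \in cutset S) = (tail eps f \notin S) && (head eps f \in S).
Proof.
move/out_closedP/(_ f); rewrite (in_cutset_orient eps).
by case: (tail eps f \in S); case: (head eps f \in S) => // ->.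
Qed.

Definition dicut eps C :=
  (C != set0) && [exists S, out_closed eps S && (C == cutset S)].

Lemma dicutP eps C :
  reflect (exists S, [/\ out_closed eps S, cutset S != set0 & C = cutset S])
          (dicut eps C).
Proof.
apply: (iffP andP) => [[C0 /existsP[S /andP[clS /eqP CS]]]|[S [clS S0 ->]]].
  by exists S; rewrite -CS.
by split=> //; apply/existsP; exists S; rewrite clS eqxx.
Qed.

Lemma out_closedI eps S T : cutset T \subset cutset S ->
  out_closed eps S -> out_closed eps (S :&: T).
Proof.
move=> /subsetP TS clS; apply/out_closedP => f; rewrite !inE => /andP[tS tT].
have fS : f \notin cutset S by rewrite (in_cutset_out_closed _ clS) tS.
have := contra (TS f) fS; rewrite (in_cutset_orient eps) negbK tT => /eqP<-.
by rewrite andbT; move/out_closedP: clS; apply.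
Qed.

Lemma out_closedU eps S T : cutset T \subset cutset S ->
  out_closed eps S -> out_closed eps (S :|: T).
Proof.
move=> /subsetP TS clS; apply/out_closedP => f; rewrite !inE.
case: (boolP (head eps f \in S)) => //= hS tST.
have fS : f \notin cutset S by rewrite (in_cutset_out_closed _ clS) (negbTE hS) andbF.
have := contra (TS f) fS; rewrite (in_cutset_orient eps) negbK => /eqP <-.
by move: tST fS; rewrite (in_cutset_orient eps) (negbTE hS); case: (_ \in S).
Qed.

(* If a cut [T] lies inside the minimal directed cut of [S], then [S :&: T] and
   [S :|: T] are out-closed as well, so both have the cut of [S]. *)
Lemma minset_dicut_sub eps S T f :
  minset (dicut eps) (cutset S) -> out_closed eps S ->
  cutset T \subset cutset S -> f \in cutset T -> head eps f \in T ->
  cutset S \subset cutset T.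
Proof.
move=> minS clS TS fT hT.
have /andP[tS hS] : (tail eps f \notin S) && (head eps f \in S).
  by rewrite -in_cutset_out_closed // (subsetP TS).
have tT : tail eps f \notin T.
  by move: fT; rewrite (in_cutset_orient eps) hT; case: (_ \in T).
have full A : out_closed eps A -> f \in cutset A ->
    cutset A \subset cutset S :|: cutset T -> cutset A = cutset S.
  move=> clA fA; rewrite (setUidPl TS) => /(minsetinf minS); apply.
  by apply/dicutP; exists A; split=> //; apply/set0Pn; exists f.
have SI : cutset (S :&: T) = cutset S.
  apply: full (cutsetI_sub S T); first exact: out_closedI.
  by rewrite (in_cutset_orient eps) !inE hS hT (negbTE tS).
have SU : cutset (S :|: T) = cutset S.
  apply: full (cutsetU_sub S T); first exact: out_closedU.
  by rewrite (in_cutset_orient eps) !inE hS (negbTE tS) (negbTE tT).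
apply/subsetP => g gS.
have gI : g \in cutset (S :&: T) by rewrite SI.
have gU : g \in cutset (S :|: T) by rewrite SU.
move: gS gI gU; rewrite (in_cutset_out_closed _ clS) !(in_cutset_orient eps) !inE.
by move=> /andP[/negbTE-> ->] /=; case: (_ \in T); case: (_ \in T).
Qed.

Lemma minset_dicut_bond eps C : minset (dicut eps) C -> directed_bond eps C.
Proof.
move=> minC; have /dicutP[S [clS S0 CS]] := minsetp minC; rewrite CS in minC *.
have pS : proper_side S by case/set0Pn: S0 => f /cutset_proper.
apply/andP; split; last by apply/existsP; exists S; rewrite pS eqxx (eqP clS) eqxx.
apply/and3P; split; first by apply/existsP; exists S; rewrite pS eqxx.
  exact: S0.
apply/forall_inP => D /andP[/andP[/existsP[T /andP[_ /eqP->]] /set0Pn[f fT]] TS].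
rewrite eqEsubset TS /=; have [hT|hT] := boolP (head eps f \in T).
  exact: (minset_dicut_sub minC clS TS fT hT).
rewrite -(cutsetC T) in TS fT *.
by apply: (minset_dicut_sub minC clS TS fT); rewrite inE.
Qed.

Lemma directed_bond_dicut eps C : directed_bond eps C -> dicut eps C.
Proof.
case/andP=> /and3P[_ C0 _] /existsP[S /and3P[_ /eqP CS dS]].
rewrite /dicut C0; apply/existsP; case/orP: dS => dS.
  by exists S; rewrite /out_closed dS CS eqxx.
by exists (~: S); rewrite /out_closed dS cutsetC CS eqxx.
Qed.

Lemma directed_bond_directed_cut eps C :
  directed_bond eps C -> directed_cut eps C.
Proof.
move=> bC; apply/andP; split; first by case/andP: bC => /and3P[].
apply/existsP; exists [set C]; apply/and3P; split.
- by apply/trivIsetP => A B /set1P-> /set1P->; rewrite eqxx.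
- by apply/forall_inP => B /set1P->.
- by rewrite /cover big_set1.
Qed.

Lemma BOP eps :
  reflect (forall S, out_closed eps S -> cutset S = set0) (eps \in BO G).
Proof.
rewrite inE; apply: (iffP forall_inP) => [noC S clS|noS C C0].
  apply/eqP/contraT => S0; have [|B minB _] := @minset_exists _ (dicut eps) (cutset S).
    by apply/dicutP; exists S.
  have bB := minset_dicut_bond minB.
  have B0 : B != set0 by case/andP: bB => /and3P[].
  by have := noC B B0; rewrite directed_bond_directed_cut.
apply/negP => /andP[_ /existsP[P /and3P[_ /forall_inP bP /eqP PC]]].
move: C0; rewrite -PC => /set0Pn[f /bigcupP[B /bP/directed_bond_dicut]].
by case/dicutP => S [/noS -> /eqP].
Qed.

Lemma out_closed_cutset1 eps S e :
  cutset S = [set e] -> tail eps e \notin S -> out_closed eps S.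
Proof.
move=> Se tS; apply/out_closedP => f fS; apply: contraNT tS => hS.
have : f \in cutset S by rewrite (in_cutset_orient eps) fS (negbTE hS).
by rewrite Se => /set1P <-.
Qed.

Lemma BO_bridge e : is_bridge e -> BO G = set0.
Proof.
case/bridgeP => S Se; apply/setP => eps; rewrite [RHS]inE; apply/negP => /BOP noS.
suff [T clT Te] : exists2 T, out_closed eps T & cutset T = [set e].
  by have := set11 e; rewrite -Te noS ?inE.
have [tS|tS] := boolP (tail eps e \in S).
  exists (~: S); rewrite ?cutsetC //.
  by apply: (@out_closed_cutset1 _ _ e); rewrite ?cutsetC ?inE ?tS.
by exists S => //; apply: out_closed_cutset1 tS.
Qed.

End OutClosed.

Section Outdegrees.
Variable G : graph.
Local Notation V := (gV G).
Implicit Types (S : {set V}) (eps : orientation G).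

Definition outdeg eps : {ffun V -> nat} :=
  [ffun v => #|[set f | tail eps f == v]|].

Lemma sum_outdeg eps S :
  \sum_(v in S) outdeg eps v = #|[set f | tail eps f \in S]|.
Proof.
rewrite -sum1_card (partition_big (tail eps) (mem S)) => [|f] /=; last by rewrite inE.
apply: eq_bigr => v vS; rewrite ffunE -sum1_card; apply: eq_bigl => f.
by rewrite !inE; case: eqP => [->|]; rewrite ?vS ?andbF.
Qed.

Lemma eul_equivE eps1 eps2 : eul_equiv eps1 eps2 = (outdeg eps1 == outdeg eps2).
Proof.
pose D := [set f | eps1 f != eps2 f].
have outdegD eps v : outdeg eps v =
    #|[set f in D | tail eps f == v]| + #|[set f in ~: D | tail eps f == v]|.
  rewrite ffunE -(cardsID D); congr (_ + _); apply: eq_card => f.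
    by rewrite !inE andbC.
  by rewrite !inE.
have reversed v : [set f in D | head eps1 f == v] = [set f in D | tail eps2 f == v].
  by apply/setP => f; rewrite !inE /head /tail; case: (eps1 f); case: (eps2 f).
have kept v : [set f in ~: D | tail eps1 f == v] = [set f in ~: D | tail eps2 f == v].
  by apply/setP => f; rewrite !inE negbK /tail; case: eqP => //= ->.
have vertexE v :
    (#|[set f in D | head eps1 f == v]| == #|[set f in D | tail eps1 f == v]|) =
    (outdeg eps1 v == outdeg eps2 v).
  by rewrite !outdegD kept reversed eqn_add2r eq_sym.
apply/forallP/eqP => [balanced|eq_out v]; last by rewrite vertexE eq_out.
by apply/ffunP => v; apply/eqP; rewrite -vertexE.
Qed.

Definition BO_outdegs : {fset {ffun V -> nat}} := [fset outdeg eps | eps in BO G]%fset.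

Lemma alphaE : alpha G = #|` BO_outdegs|.
Proof.
rewrite -card_preim_partition /alpha; congr #|pred_of_set _|.
apply: eq_imset => eps1; apply/setP => eps2.
by rewrite !inE eul_equivE.
Qed.

End Outdegrees.

Section Demand.
Variable G : graph.
Local Notation V := (gV G).
Local Notation E := (gE G).
Implicit Types (S T : {set V}) (e f g : E) (eps : orientation G).
Implicit Types (d : {ffun V -> nat}).

Definition inside S : {set E} := [set f | (src f \in S) && (tgt f \in S)].

Lemma joins_inside e x y S :
  joins e x y -> (e \in inside S) = (x \in S) && (y \in S).
Proof. by rewrite inE => /orP[]/eqP-> //; rewrite andbC. Qed.

Definition between S T : {set E} :=
  [set f | (src f \in S) && (tgt f \in T) || (tgt f \in S) && (src f \in T)].

Lemma card_inside_setUI S T :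
  #|inside (S :|: T)| + #|inside (S :&: T)| =
  #|inside S| + #|inside T| + #|between (S :\: T) (T :\: S)|.
Proof.
rewrite -!sum1_card !(big_mkcond (fun f => f \in _)) -!big_split /=.
apply: eq_bigr => f _; rewrite !inE.
by do 2![case: (src f \in _)]; do 2![case: (tgt f \in _)].
Qed.

Lemma inside_uncross e S T : src e \in S :\: T -> tgt e \in T :\: S ->
  #|inside S| + #|inside T| < #|inside (S :|: T)| + #|inside (S :&: T)|.
Proof.
move=> eS eT; rewrite card_inside_setUI -addn1 leq_add2l card_gt0.
by apply/set0Pn; exists e; rewrite inE eS eT.
Qed.

Lemma sum_outdeg_inside eps S :
  \sum_(v in S) outdeg eps v = #|inside S| + #|dir_from eps S|.
Proof.
rewrite sum_outdeg -(cardsID [set f | head eps f \in S]); congr (_ + _).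
  by apply: eq_card => f; rewrite !inE /head /tail; case: (eps f); rewrite // andbC.
by apply: eq_card => f; rewrite in_dir_from !inE andbC.
Qed.

Definition demand S : nat := #|inside S| + (cutset S != set0).

(* A second edge [g] of the cut of [S] either joins [S :\: T] to [T :\: S], like [e], or
   leaves one of [S :|: T] and [S :&: T]. *)
Lemma demand_uncross e S T :
  ~~ is_bridge e -> src e \in S :\: T -> tgt e \in T :\: S ->
  demand S + demand T <= demand (S :|: T) + demand (S :&: T).
Proof.
move=> nbr eS eT; pose B := between (S :\: T) (T :\: S).
have eB : e \in B by rewrite inE eS eT.
have [g ge gS] : exists2 g, g != e & g \in cutset S.
  apply: nonbridge_cutset nbr _; rewrite inE.
  by move: eS eT; rewrite !inE => /andP[_ ->] /andP[/negbTE->].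
have gain : 0 < #|B :\ e| + (cutset (S :|: T) != set0) + (cutset (S :&: T) != set0).
  rewrite !addn_gt0 card_gt0 !lt0b -orbA; apply/or3P.
  have [gB|gB] := boolP (g \in B).
    by constructor 1; apply/set0Pn; exists g; rewrite in_setD1 ge.
  have [gU|gU] := boolP (g \in cutset (S :|: T)).
    by constructor 2; apply/set0Pn; exists g.
  constructor 3; apply/set0Pn; exists g; move: gS gB gU; rewrite !inE.
  by do 2![case: (src g \in _)]; do 2![case: (tgt g \in _)].
have := card_inside_setUI S T; rewrite -/B (cardsD1 e B) eB /demand.
case: (cutset S != set0); case: (cutset T != set0); lia.
Qed.

Definition admissible d : bool :=
  (\sum_(v in [set: V]) d v == #|E|) &&
  [forall S : {set V}, demand S <= \sum_(v in S) d v].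

Lemma demand_joins_gt0 e x y : joins e x y -> 0 < demand [set x].
Proof.
move=> xy; have : e \in inside [set x] :|: cutset [set x].
  by rewrite !inE; case/orP: xy => /eqP-> /=; rewrite eqxx; case: (_ == _).
rewrite /demand addn_gt0 card_gt0 lt0b.
by case/setUP => ex; apply/orP; [left | right]; apply/set0Pn; exists e.
Qed.

Lemma admissible_outdeg eps : admissible (outdeg eps) = (eps \in BO G).
Proof.
rewrite /admissible sum_outdeg (eq_card (B := E)) => [|f]; last by rewrite !inE.
rewrite eqxx; apply/forallP/BOP => [dem S clS|noS S].
  have := dem S; rewrite sum_outdeg_inside (eqP clS) cards0 leq_add2l.
  by case: eqP.
rewrite sum_outdeg_inside leq_add2l; case: eqP => //= cS.
rewrite card_gt0; apply: contra_not_neq cS => dS.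
by apply: noS; rewrite /out_closed dS.
Qed.

Lemma admissible_joins_gt0 e x y d : admissible d -> joins e x y -> 0 < d x.
Proof.
case/andP => _ /forallP/(_ [set x]) + /demand_joins_gt0; rewrite big_set1.
by move=> /[swap]; apply: leq_trans.
Qed.

Lemma admissible_src_gt0 e d : admissible d -> 0 < d (src e).
Proof. by move=> adm; apply: admissible_joins_gt0 adm (joins_ends e). Qed.

Lemma admissible_tgt_gt0 e d : admissible d -> 0 < d (tgt e).
Proof.
have vu : joins e (tgt e) (src e) by rewrite joins_sym joins_ends.
by move=> adm; apply: admissible_joins_gt0 adm vu.
Qed.

Definition tight_separated (x y : V) d : bool :=
  [exists S : {set V}, [&& x \in S, y \notin S & \sum_(v in S) d v == demand S]].

End Demand.

Section Deletion.
Variables (G : graph) (e : gE G).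
Local Notation V := (gV G).
Local Notation E := (gE G).
Implicit Types (S : {set V}) (x y : V).

Lemma card_del : #|E| = #|gE (del e)|.+1.
Proof. by rewrite -cardsT (cardsD1_sub e) cardsT addn1. Qed.

Lemma inside_del S : #|inside S| = #|@inside (del e) S| + (e \in inside S).
Proof. by rewrite {1}/inside (cardsD1_sub e) inE. Qed.

Lemma cutset_del_eq0 S : ~~ is_bridge e ->
  (@cutset (del e) S == set0) = (cutset S == set0).
Proof.
move=> nbr; apply/eqP/eqP => /setP S0; apply/setP => f; rewrite [RHS]inE; last first.
  by have := S0 (val f); rewrite !inE.
have away g : g != e -> g \notin cutset S.
  by move=> ge; have := S0 (exist _ g ge); rewrite !inE => /= ->.
have [->|/away/negbTE//] := eqVneq f e; apply/negP => eS.
by have [g /away/negP] := nonbridge_cutset nbr eS.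
Qed.

Lemma demand_del S : ~~ is_bridge e ->
  demand S = @demand (del e) S + (e \in inside S).
Proof.
by move=> nbr; rewrite /demand inside_del (cutset_del_eq0 S nbr) addnAC.
Qed.

Lemma outdeg_undel x y (eps : orientation (del e)) : joins e x y ->
  exists eps' : orientation G, outdeg eps' = incr x (outdeg eps).
Proof.
move=> xy; exists [ffun f => if insub f is Some f' then eps f' else gends e == (x, y)].
apply/ffunP => v; rewrite !ffunE (cardsD1_sub e); congr (_ + _).
  by apply: eq_card => f; rewrite !inE /tail ffunE valK.
rewrite eq_sym /tail ffunE insubF ?eqxx //; congr (_ == _ : nat).
by case/orP: xy => /eqP->; rewrite ?eqxx //; case: eqP => // -[].
Qed.

End Deletion.

(* An edge joining [x] and [y] can be charged to [x] unless some tight set contains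
   [x] but not [y], and opposite tight sets are excluded by uncrossing. *)
Lemma hakimi (G : graph) (d : {ffun gV G -> nat}) :
  \sum_(v in [set: gV G]) d v = #|gE G| ->
  (forall S, #|inside S| <= \sum_(v in S) d v) ->
  exists eps, outdeg eps = d.
Proof.
move En: #|gE G| => n; elim: n G En d => [|n IH] G En d tot dom.
  exists [ffun => true]; apply/ffunP => v; rewrite ffunE.
  have /eqP-> : #|[set f : gE G | tail [ffun => true] f == v]| == 0.
    by rewrite -leqn0 -En max_card.
  by move/eqP: tot; rewrite sum_nat_eq0 => /forall_inP/(_ v (in_setT _))/eqP.
have /card_gt0P[e _] : 0 < #|gE G| by rewrite En.
pose slack x y := [forall S : {set gV G},
  (x \in S) && (y \notin S) ==> (#|inside S| < \sum_(v in S) d v)].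
have charge x y : joins e x y -> slack x y -> exists eps, outdeg eps = d.
  move=> xy /forallP xy_slack.
  have room (S : {set gV G}) : #|@inside (del e) S| + (x \in S) <= \sum_(v in S) d v.
    have := dom S; have := xy_slack S; rewrite (inside_del e S) (joins_inside S xy).
    by case: (x \in S); case: (y \in S); rewrite /= ?addn0 ?addn1.
  have [|d0 dE] := @incr_surj _ x d.
    by have := room [set x]; rewrite big_set1 set11; case: (d x); rewrite // addn1.
  have [|||eps' eps'E] := IH (del e) _ d0.
  - by move: En; rewrite (card_del e) => -[].
  - by have := tot; rewrite dE sum_incr in_setT addn1 => -[].
  - by move=> S; have := room S; rewrite dE sum_incr leq_add2r.
  by rewrite dE -eps'E; apply: outdeg_undel xy.
have uv := joins_ends e; have vu := uv; rewrite joins_sym in vu.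
have [/(charge _ _ uv)//|/forallPn[S]] := boolP (slack (src e) (tgt e)).
have [/(charge _ _ vu)//|/forallPn[T]] := boolP (slack (tgt e) (src e)).
rewrite !negb_imply -!leqNgt => /andP[/andP[vT uT] tightT] /andP[/andP[uS vS] tightS].
have := @inside_uncross _ e S T; rewrite !inE uS uT vS vT => /(_ isT isT).
have := dom (S :|: T); have := dom (S :&: T); have := sum_setUI S T d; lia.
Qed.

Lemma mem_BO_outdegs (G : graph) d : (d \in BO_outdegs G) = admissible d.
Proof.
apply/imfsetP/idP => [[/= eps epsB ->]|adm]; first by rewrite admissible_outdeg.
have [/eqP tot /forallP dem] := andP adm; have [S|eps dE] := hakimi tot.
  by apply: leq_trans (dem S); apply: leq_addr.
by exists eps; rewrite //= -admissible_outdeg dE.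
Qed.

Section AlphaDeletion.
Variable G : graph.
Local Notation V := (gV G).
Implicit Types (e : gE G) (d : {ffun V -> nat}).

Lemma admissible_incr_del e d : ~~ is_bridge e ->
  admissible (incr (src e) d) && ~~ tight_separated (src e) (tgt e) (incr (src e) d) =
  @admissible (del e) d.
Proof.
move=> nbr; rewrite /admissible sum_incr in_setT addn1 (card_del e) eqSS -andbA.
have slackE (S : {set V}) :
    (demand S <= \sum_(v in S) incr (src e) d v) &&
    ~~ [&& src e \in S, tgt e \notin S & \sum_(v in S) incr (src e) d v == demand S] =
    (@demand (del e) S <= \sum_(v in S) d v).
  rewrite (demand_del S nbr) sum_incr inE.
  by case: (src e \in S); case: (tgt e \in S) => /=; lia.
congr (_ && _); apply/andP/forallP => [[/forallP dem /existsPn sep] S|dem].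
  by rewrite -slackE dem sep.
by split; [apply/forallP => S | apply/existsPn => S]; have := dem S;
  rewrite -slackE => /andP[].
Qed.

Lemma alpha_del e : ~~ is_bridge e ->
  alpha (del e) =
  #|` [fset d in BO_outdegs G | ~~ tight_separated (src e) (tgt e) d]%fset|.
Proof.
move=> nbr; rewrite alphaE.
transitivity #|` (incr (src e) @` BO_outdegs (del e))%fset|.
  by rewrite [RHS]card_imfset //; apply: incr_inj.
congr #|` _|; apply/fsetP => d; rewrite !inE mem_BO_outdegs.
apply/imfsetP/idP => [[d0]|/andP[adm sep]].
  rewrite [_ \in _](@mem_BO_outdegs (del e)) -(admissible_incr_del _ nbr).
  by move=> /[swap] ->.
have [d0 dE] := incr_surj (admissible_src_gt0 e adm).
exists d0; rewrite // [_ \in _](@mem_BO_outdegs (del e)).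
by rewrite -(admissible_incr_del _ nbr) -dE adm.
Qed.

Lemma alpha_loop e : is_loop e -> alpha G = alpha (del e).
Proof.
move=> lp; rewrite (alpha_del (loop_nonbridge lp)) alphaE.
congr #|` _|; apply/fsetP => d; rewrite !inE (eqP lp).
rewrite [tight_separated _ _ _](_ : _ = false) ?andbT //.
by apply/existsP => -[S /and3P[-> ]].
Qed.

End AlphaDeletion.

Lemma alpha_bridge (G : graph) (e : gE G) : is_bridge e -> alpha G = 0.
Proof. by move=> br; rewrite /alpha (BO_bridge br) imset0 cards0. Qed.

Section Contraction.
Variables (G : graph) (e : gE G) (nloop : (gends e).1 != (gends e).2).
Local Notation V := (gV G).
Local Notation G' := (contr nloop).
Local Notation u := (gends e).1.
Local Notation v := (gends e).2.
Local Notation vmap := (contr_vmap nloop).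
Local Notation pre W := (contr_vmap nloop @^-1: W).
Implicit Types (S T : {set V}) (W : {set gV G'}).
Implicit Types (d : {ffun V -> nat}) (c : {ffun gV G' -> nat}) (t : nat).

Lemma contr_vmap_val (w : gV G') : vmap (val w) = w.
Proof. by apply: val_inj => /=; rewrite (negbTE (valP w)). Qed.

Lemma contr_vmap_tgt : vmap v = vmap u.
Proof. by apply: val_inj => /=; rewrite eqxx (negbTE nloop). Qed.

Lemma in_preim_ends W : (u \in pre W) = (v \in pre W).
Proof. by rewrite !inE contr_vmap_tgt. Qed.

Lemma preim_contr_surj S : (u \in S) = (v \in S) -> exists W, S = pre W.
Proof.
move=> uv; exists [set w | val w \in S]; apply/setP => x; rewrite !inE /=.
by case: eqP => [->|].
Qed.

Lemma in_cutset_preim W (f : gE G') : (val f \in cutset (pre W)) = (f \in cutset W).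
Proof. by rewrite !inE. Qed.

Lemma notin_cutset_preim W : e \notin cutset (pre W).
Proof. by rewrite inE in_preim_ends eqxx. Qed.

Lemma cutset_preim_eq0 W : (cutset (pre W) == set0) = (cutset W == set0).
Proof.
apply/eqP/eqP => /setP W0; apply/setP => f; rewrite [RHS]inE.
  by rewrite -in_cutset_preim W0 inE.
have [->|fe] := eqVneq f e; first by apply/negbTE/notin_cutset_preim.
by have := W0 (exist _ f fe); rewrite -in_cutset_preim [RHS]inE.
Qed.

Lemma demand_preim W : demand (pre W) = demand W + (vmap u \in W).
Proof.
rewrite /demand cutset_preim_eq0 addnAC; congr (_ + _).
rewrite [in LHS]/inside (cardsD1_sub e) !inE contr_vmap_tgt andbb; congr (_ + _).
by apply: eq_card => f; rewrite !inE.
Qed.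

Lemma sum_preim d W : \sum_(x in pre W) d x =
  \sum_(w in W) d (val w) + (vmap u \in W) * d v.
Proof.
rewrite big_mkcond (bigD1 v) //= inE contr_vmap_tgt addnC [in RHS]big_mkcond /=.
congr (_ + _); last by case: (_ \in W); rewrite ?mul1n.
rewrite (big_sub (predC1 v)); apply: eq_bigr => w _.
by rewrite inE contr_vmap_val.
Qed.

(* The contracted edge accounts for one unit of outdegree at the merged vertex. *)
Definition merge d : {ffun gV G' -> nat} :=
  [ffun w => d (val w) + (w == vmap u) * (d v).-1].

Lemma sum_merge d W : 0 < d v ->
  \sum_(x in pre W) d x = \sum_(w in W) merge d w + (vmap u \in W).
Proof.
move=> dv; under [in RHS]eq_bigr do rewrite ffunE.
rewrite sum_preim big_split -big_distrl sum_eq_op /= -addnA; congr (_ + _).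
by case: (_ \in W); case: (d v) dv => // n; rewrite !mul1n addn1.
Qed.

Lemma admissible_merge d : admissible d -> admissible (merge d).
Proof.
move=> adm; have dv := admissible_tgt_gt0 e adm.
case/andP: adm => /eqP tot /forallP dem; apply/andP; split.
  have := sum_merge setT dv; rewrite preimsetT tot in_setT (card_del e) addn1.
  by move=> [->].
by apply/forallP => W; have := dem (pre W); rewrite demand_preim sum_merge // leq_add2r.
Qed.

(* Off [u] and [v] the two agree, so [d1] would violate a tight set of [d2] containing
   [u] but not [v] if [d1 u] were smaller. *)
Lemma merge_tight_le d1 d2 : admissible d1 -> tight_separated u v d2 ->
  merge d1 = merge d2 -> d2 u <= d1 u.
Proof.
case/andP => _ /forallP dem /existsP[S /and3P[uS vS /eqP tS]] /ffunP eq_merge.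
have := dem S; rewrite -tS (big_setD1 u) //= [X in _ <= X](big_setD1 u) //=.
suff -> : \sum_(x in S :\ u) d1 x = \sum_(x in S :\ u) d2 x by rewrite leq_add2r.
apply: eq_bigr => x; rewrite !inE => /andP[xu xS].
have xv : x != v by apply: contraNneq vS => <-.
have := eq_merge (exist _ x xv); rewrite !ffunE -val_eqE /= (negbTE nloop) (negbTE xu).
by rewrite !mul0n !addn0.
Qed.

Lemma merge_inj d1 d2 :
  admissible d1 -> tight_separated u v d1 ->
  admissible d2 -> tight_separated u v d2 ->
  merge d1 = merge d2 -> d1 = d2.
Proof.
move=> adm1 sep1 adm2 sep2 eq_merge.
have eq_u : d1 u = d2 u by apply/eqP; rewrite eqn_leq !merge_tight_le.
have d1v := admissible_tgt_gt0 e adm1; have d2v := admissible_tgt_gt0 e adm2.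
apply/ffunP => x; move/ffunP/(_ (vmap x)): eq_merge.
rewrite !ffunE -val_eqE /= (negbTE nloop).
have [->|xv] := eqVneq x v; first by rewrite eqxx eq_u !mul1n => /addnI; lia.
by have [->|xu] := eqVneq x u; rewrite // !mul0n !addn0.
Qed.

Definition unmerge t c : {ffun V -> nat} :=
  [ffun x => if x == u then t else
             if x == v then (c (vmap u)).+1 - t else c (vmap x)].

Lemma unmergeK t c : t <= c (vmap u) -> merge (unmerge t c) = c.
Proof.
move=> le_t; apply/ffunP => w; have xv : val w != v := valP w.
rewrite !ffunE eqxx [v == u]eq_sym (negbTE nloop) (negbTE xv) contr_vmap_val.
rewrite -val_eqE /= (negbTE nloop).
have [wu|_] := eqVneq (val w) u; last by rewrite mul0n addn0.
have wE : w = vmap u by rewrite -wu contr_vmap_val.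
by rewrite wE mul1n subSn // subnKC.
Qed.

Lemma sum_unmerge t c S : t <= c (vmap u) ->
  \sum_(x in S) unmerge t c x + (v \in S) * t =
  \sum_(x in S) unmerge 0 c x + (u \in S) * t.
Proof.
move=> le_t; rewrite -!sum_eq_op !big_distrl -!big_split; apply: eq_bigr => x _ /=.
rewrite !ffunE; have [->|_] := eqVneq x u; first by rewrite (negbTE nloop); lia.
by case: eqP => _; lia.
Qed.

Lemma sum_unmerge0_preim c W :
  \sum_(x in pre W) unmerge 0 c x = \sum_(w in W) c w + (vmap u \in W).
Proof.
rewrite sum_merge ?unmergeK //.
by rewrite ffunE eq_sym (negbTE nloop) eqxx.
Qed.

Section MergeSurjective.
Variable c : {ffun gV G' -> nat}.
Hypothesis nbr : ~~ is_bridge e.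
Hypothesis adm_c : admissible c.

Lemma demand_unmerge0 S : (u \in S) = (v \in S) ->
  demand S <= \sum_(x in S) unmerge 0 c x.
Proof.
case/preim_contr_surj => W ->; rewrite demand_preim sum_unmerge0_preim leq_add2r.
by case/andP: adm_c => _ /forallP.
Qed.

Lemma demand_unmerge0_uncross S T :
  u \in S :\: T -> v \in T :\: S ->
  demand S + demand T <=
  \sum_(x in S) unmerge 0 c x + \sum_(x in T) unmerge 0 c x.
Proof.
move=> uST vTS; rewrite -sum_setUI.
apply: leq_trans (demand_uncross nbr uST vTS) (leq_add _ _);
  apply: demand_unmerge0; move: uST vTS; rewrite !inE;
  by move=> /andP[/negbTE-> ->] /andP[/negbTE-> ->].
Qed.

Lemma admissible_unmerge t : t <= c (vmap u) ->
  (forall S, u \in S -> v \notin S -> demand S <= \sum_(x in S) unmerge 0 c x + t) ->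
  (forall T, v \in T -> u \notin T -> demand T + t <= \sum_(x in T) unmerge 0 c x) ->
  admissible (unmerge t c).
Proof.
move=> le_t levelS levelT; apply/andP; split.
  have /eqP := sum_unmerge setT le_t; rewrite !in_setT eqn_add2r => /eqP->.
  rewrite -{1}(preimsetT vmap) sum_unmerge0_preim in_setT addn1 (card_del e) eqSS.
  by case/andP: adm_c.
apply/forallP => S; have := sum_unmerge S le_t.
case uS: (u \in S); case vS: (v \in S) => /=.
- have := @demand_unmerge0 S; rewrite uS vS => /(_ erefl); lia.
- have := levelS S uS (negbT vS); lia.
- have := levelT S vS (negbT uS); lia.
- have := @demand_unmerge0 S; rewrite uS vS => /(_ erefl); lia.
Qed.

(* The least value at [u] is the largest deficit of a set containing [u] but not [v]. *)
Lemma tight_level_exists : exists t, [/\ t <= c (vmap u),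
  forall S, u \in S -> v \notin S -> demand S <= \sum_(x in S) unmerge 0 c x + t,
  forall T, v \in T -> u \notin T -> demand T + t <= \sum_(x in T) unmerge 0 c x &
  exists S, [/\ u \in S, v \notin S & demand S = \sum_(x in S) unmerge 0 c x + t]].
Proof.
pose deficit S := demand S - \sum_(x in S) unmerge 0 c x.
have deficit_u : 0 < deficit [set u].
  by rewrite /deficit big_set1 ffunE eqxx subn0 (demand_joins_gt0 (joins_ends e)).
have u_sep : (u \in [set u]) && (v \notin [set u]) by rewrite !inE eqxx eq_sym.
case: (@arg_maxnP _ [set u] (fun S => (u \in S) && (v \notin S)) deficit u_sep).
move=> S /andP[uS vS] maxS.
have tightS : demand S = \sum_(x in S) unmerge 0 c x + deficit S.
  by have := maxS _ u_sep; rewrite /deficit in deficit_u *; lia.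
have levelT T : v \in T -> u \notin T ->
    demand T + deficit S <= \sum_(x in T) unmerge 0 c x.
  move=> vT uT; have := @demand_unmerge0_uncross S T; rewrite !inE uS uT vS vT.
  by rewrite tightS => /(_ isT isT); lia.
exists (deficit S); split=> //; last by exists S.
  have := levelT [set v]; rewrite big_set1 !ffunE eqxx eq_sym (negbTE nloop) !inE eqxx.
  have vu : joins e v u by rewrite joins_sym joins_ends.
  have := demand_joins_gt0 vu.
  by move=> + /(_ isT nloop); lia.
by move=> T uT vT; have := maxS T; rewrite uT vT /deficit => /(_ isT); lia.
Qed.

Lemma merge_surj :
  exists d, [/\ admissible d, tight_separated u v d & merge d = c].
Proof.
have [t [le_t levelS levelT [S [uS vS tightS]]]] := tight_level_exists.
exists (unmerge t c); split; [exact: admissible_unmerge | | exact: unmergeK].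
apply/existsP; exists S; rewrite uS vS /=.
by have := sum_unmerge S le_t; rewrite uS (negbTE vS) tightS; lia.
Qed.

End MergeSurjective.

Lemma alpha_contr : ~~ is_bridge e ->
  alpha G' = #|` [fset d in BO_outdegs G | tight_separated u v d]%fset|.
Proof.
move=> nbr; rewrite alphaE.
transitivity #|` (merge @` [fset d in BO_outdegs G | tight_separated u v d])%fset|.
  congr #|` _|; apply/fsetP => c; rewrite mem_BO_outdegs; apply/idP/imfsetP => /=.
    case/(merge_surj nbr) => d [adm sep <-]; exists d => //.
    by rewrite !inE /= mem_BO_outdegs adm.
  by case=> d; rewrite !inE mem_BO_outdegs => /andP[adm _] ->; apply: admissible_merge.
rewrite card_in_imfset // => d1 d2; rewrite !inE !mem_BO_outdegs.
by move=> /andP[adm1 sep1] /andP[adm2 sep2]; apply: merge_inj.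
Qed.

Lemma alpha_del_contr : ~~ is_bridge e -> alpha G = alpha (del e) + alpha G'.
Proof.
move=> nbr; rewrite alpha_del // alpha_contr // addnC alphaE.
rewrite -(cardfsID [fset d in BO_outdegs G | tight_separated u v d]%fset).
by congr (_ + _); congr #|` _|; apply/fsetP => d; rewrite !inE;
  case: (d \in BO_outdegs G); case: (tight_separated _ _ _).
Qed.

End Contraction.

Section Forests.
Variable G : graph.
Local Notation V := (gV G).
Local Notation E := (gE G).
Implicit Types (S : {set V}) (F X : {set E}) (e f g : E) (r : E -> nat).

Definition forest F : bool :=
  [forall f in F, [exists S : {set V}, cutset S :&: F == [set f]]].

Lemma forestP F :
  reflect (forall f, f \in F -> exists S, cutset S :&: F = [set f]) (forest F).
Proof.
apply: (iffP forall_inP) => cutF f /cutF; first by case/existsP => S /eqP; exists S.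
by case=> S SF; apply/existsP; exists S; rewrite SF.
Qed.

Lemma cutset1_mem F S f : cutset S :&: F = [set f] -> f \in cutset S /\ f \in F.
Proof. by move/setP/(_ f); rewrite in_setI set11 => /andP. Qed.

Lemma forest_loop F e : forest F -> is_loop e -> e \notin F.
Proof.
move=> /forestP cutF lp; apply/negP => /cutF[S /cutset1_mem[eS _]].
by have := loop_notin_cutset S lp; rewrite eS.
Qed.

Lemma forest_trace F X : forest F -> X \subset F ->
  exists S, cutset S :&: F = X.
Proof.
move=> /forestP cutF; move En: #|X| => n; elim: n X En => [|n IH] X En XF.
  by exists set0; rewrite cutset0 set0I (cards0_eq En).
have /card_gt0P[x xX] : 0 < #|X| by rewrite En.
have [S SF] := cutF x (subsetP XF x xX).
have [||T TF] := IH (X :\ x).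
- by apply/eqP; rewrite -eqSS -En (cardsD1 x X) xX.
- exact: subset_trans (subsetDl _ _) XF.
exists (symdiff S T); rewrite cutset_symdiff symdiffIl SF TF.
by apply/setP => f; rewrite !inE; have [->|] := eqVneq f x; rewrite ?xX.
Qed.

Lemma connectsAll_cutset1 F S f : connectsAll F -> proper_side S ->
  cutset S :&: (F :\ f) = set0 -> cutset S :&: F = [set f].
Proof.
move=> /connectsAllP cF pS SFf.
have : cutset S :&: F \subset [set f] by rewrite -setD_eq0 -setIDA SFf.
by rewrite subset1 (negbTE (cF S pS)) orbF => /eqP.
Qed.

Lemma spanning_treeE F : spanning_tree F = connectsAll F && forest F.
Proof.
rewrite /spanning_tree; have [cF /=|//] := boolP (connectsAll F).
apply/forall_inP/forestP => [minF f /minF/connectsAllPn[S pS SFf]|cutF f /cutF[S SF]].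
  by exists S; apply: connectsAll_cutset1.
apply/connectsAllPn; exists S; last by rewrite setIDA SF setDv.
by case: (cutset1_mem SF) => /cutset_proper.
Qed.

Lemma spanning_tree_cut F f : spanning_tree F -> f \in F ->
  exists S, cutset S :&: F = [set f].
Proof. by rewrite spanning_treeE => /andP[_ /forestP]; apply. Qed.

Lemma tree_exchange F S f g :
  spanning_tree F -> cutset S :&: F = [set f] -> g \in cutset S ->
  spanning_tree ((F :\ f) :|: [set g]).
Proof.
rewrite !spanning_treeE => /andP[cF /forestP cutF] SF gS.
have trace T : cutset T :&: ((F :\ f) :|: [set g]) =
               ((cutset T :&: F) :\ f) :|: (cutset T :&: [set g]).
  by rewrite setIUr setIDA.
have cutg T : g \in cutset T -> cutset T :&: [set g] = [set g].
  by move=> gT; apply/setIidPr; rewrite sub1set.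
have Sg : cutset S :&: ((F :\ f) :|: [set g]) = [set g].
  by rewrite trace SF setDv set0U cutg.
apply/andP; split.
  apply/connectsAllP => T pT; apply/negP; rewrite trace setU_eq0.
  case/andP=> /eqP Tf /eqP Tg.
  have TF : cutset T :&: F = [set f] by apply: connectsAll_cutset1; rewrite // setIDA.
  have gST : g \in cutset (symdiff S T).
    by rewrite cutset_symdiff inE gS; move/setP/(_ g): Tg; rewrite !inE eqxx andbT => ->.
  move/connectsAllP/(_ _ (cutset_proper gST)): cF.
  by rewrite cutset_symdiff symdiffIl SF TF symdiffvv eqxx.
apply/forestP => h; rewrite in_setU in_set1 in_setD1.
case/orP=> [/andP[hf hF]|/eqP->]; last by exists S.
have hg : h != g.
  by apply: contraNneq hf => hg; rewrite -in_set1 -SF inE hg gS -hg.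
have [T Th] := cutF h hF.
have [gT|gT] := boolP (g \in cutset T); [exists (symdiff T S) | exists T].
  rewrite cutset_symdiff symdiffIl Sg trace Th (cutg T gT).
  apply/setP => k; rewrite !inE; have [->|_] := eqVneq k h; last by rewrite andbF addbb.
  by rewrite hf (negbTE hg).
rewrite trace Th; apply/setP => k; rewrite in_setU in_setD1 in_setI !in_set1.
have [->|_] := eqVneq k h; first by rewrite hf.
by have [->|_] := eqVneq k g; rewrite ?(negbTE gT) !andbF.
Qed.

Lemma fund_cutE F S f :
  spanning_tree F -> cutset S :&: F = [set f] -> fund_cut F f = cutset S.
Proof.
move=> tF SF; apply/setP => g; rewrite inE.
apply/idP/idP => [|gS]; last exact: tree_exchange SF gS.
rewrite spanning_treeE => /andP[/connectsAllP cFg _].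
have [/cutset_proper pS _] := cutset1_mem SF.
have := cFg S pS; rewrite setIUr setIDA SF setDv set0U => /set0Pn[h].
by rewrite !inE => /andP[hS /eqP <-].
Qed.

Lemma int_activeE r F S f :
  spanning_tree F -> cutset S :&: F = [set f] ->
  int_active r F f = [forall g in cutset S, r f <= r g].
Proof.
move=> tF SF; rewrite /int_active (fund_cutE tF SF).
by have [_ ->] := cutset1_mem SF.
Qed.

Definition inactive_tree r F : bool :=
  spanning_tree F && [forall f in F, ~~ int_active r F f].

Lemma bridge_int_active r e F : is_bridge e -> spanning_tree F ->
  (e \in F) && int_active r F e.
Proof.
case/bridgeP => S Se tF; have eS : e \in cutset S by rewrite Se set11.
have SF : cutset S :&: F = [set e].
  move: tF; rewrite spanning_treeE => /andP[cF _].
  apply: connectsAll_cutset1 cF (cutset_proper eS) _.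
  by apply: disjoint_setI0; rewrite Se disjoints1 setD11.
have [_ ->] := cutset1_mem SF.
by rewrite (int_activeE r tF SF); apply/forall_inP => g; rewrite Se => /set1P->.
Qed.

Lemma trees_no_int_active_bridge r e : is_bridge e -> trees_no_int_active r = 0.
Proof.
move=> br; apply: eq_card0 => F; rewrite inE; apply/andP => -[tF /forall_inP inact].
by have /andP[/inact/negP] := bridge_int_active r br tF.
Qed.

Lemma max_not_int_active r e F : injective r -> (forall f, r f <= r e) ->
  ~~ is_bridge e -> spanning_tree F -> e \in F -> ~~ int_active r F e.
Proof.
move=> r_inj r_max nbr tF eF.
have [S SF] := spanning_tree_cut tF eF.
have [eS _] := cutset1_mem SF.
have [g ge gS] := nonbridge_cutset nbr eS.
rewrite (int_activeE r tF SF); apply/forall_inPn; exists g => //.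
by rewrite -ltnNge ltn_neqAle r_max andbT (inj_eq r_inj).
Qed.

End Forests.

Section Minors.
Variables (G : graph) (e : gE G).
Local Notation E' := {f : gE G | f != e}.
Implicit Types (F : {set E'}) (S : {set gV G}).

Lemma imset_cutset_del S F :
  val @: (@cutset (del e) S :&: F) = cutset S :&: val @: F.
Proof.
rewrite -imset_preimsetI; congr (_ @: (_ :&: _)).
by apply/setP => f; rewrite !inE.
Qed.

Lemma connectsAll_del F : @connectsAll (del e) F = connectsAll (val @: F).
Proof.
apply/connectsAllP/connectsAllP => cF S /cF; last first.
  by rewrite -imset_cutset_del imset_eq0.
by rewrite -(imset_eq0 val) [_ @: _]imset_cutset_del.
Qed.

Lemma cutset1_del S F (f : E') :
  (@cutset (del e) S :&: F = [set f]) <-> (cutset S :&: val @: F = [set val f]).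
Proof.
rewrite -imset_cutset_del -imset_set1; split=> [-> //|].
by apply: imset_inj; apply: val_inj.
Qed.

Lemma forest_del F : @forest (del e) F = forest (val @: F).
Proof.
apply/forestP/forestP => cutF f; last first.
  rewrite -(mem_imset F _ val_inj) => /cutF[S /cutset1_del SF].
  by exists S.
by case/imsetP => h /cutF[S SF] ->; exists S; apply/cutset1_del.
Qed.

Lemma spanning_tree_del F : @spanning_tree (del e) F = spanning_tree (val @: F).
Proof. by rewrite !spanning_treeE connectsAll_del forest_del. Qed.

Section ContractedForests.
Hypothesis nloop : (gends e).1 != (gends e).2.
Local Notation G' := (contr nloop).
Local Notation pre W := (contr_vmap nloop @^-1: W).
Implicit Types (W : {set gV G'}).

Lemma imset_cutset_contr W F :
  val @: (cutset W :&: F) = cutset (pre W) :&: (e |: val @: F).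
Proof.
have -> : cutset W = val @^-1: cutset (pre W).
  by apply/setP => f; rewrite [RHS]inE in_cutset_preim.
rewrite imset_preimsetI setIUr (setIC _ [set e]).
by rewrite (disjoint_setI0 (A := [set e])) ?set0U // disjoints1 notin_cutset_preim.
Qed.

Lemma proper_side_preim W : proper_side (pre W) = proper_side W.
Proof.
apply/proper_sideP/proper_sideP => -[x [y [xW yW]]].
  by exists (contr_vmap nloop x), (contr_vmap nloop y); rewrite !inE in xW yW.
by exists (val x), (val y); rewrite !inE !contr_vmap_val.
Qed.

Lemma connectsAll_contr F : @connectsAll G' F = connectsAll (e |: val @: F).
Proof.
apply/connectsAllP/connectsAllP => cF S pS; last first.
  by rewrite -(imset_eq0 val) imset_cutset_contr cF ?proper_side_preim.
have [uvS|uvS] := eqVneq (src e \in S) (tgt e \in S).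
  have [W SW] := preim_contr_surj nloop uvS; rewrite SW -imset_cutset_contr imset_eq0.
  by apply: cF; rewrite -proper_side_preim -SW.
by apply/set0Pn; exists e; rewrite in_setI setU11 andbT inE.
Qed.

Lemma cutset1_contr W F (f : E') :
  (cutset W :&: F = [set f]) <-> (cutset (pre W) :&: (e |: val @: F) = [set val f]).
Proof.
rewrite -imset_cutset_contr -imset_set1; split=> [-> //|].
by apply: imset_inj; apply: val_inj.
Qed.

(* The cut of [src e] is corrected by a cut of the contraction with the same trace
   on [F]. *)
Lemma forest_contr_cut F : @forest G' F ->
  exists S, cutset S :&: (e |: val @: F) = [set e].
Proof.
move=> fF; pose C := cutset [set src e].
have eC : e \in C by rewrite !inE eqxx [tgt e == _]eq_sym (negbTE nloop).
have [W WF] := @forest_trace G' F _ fF (subsetIr (val @^-1: C) F).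
exists (symdiff [set src e] (pre W)).
rewrite cutset_symdiff symdiffIl -imset_cutset_contr WF imset_preimsetI -/C.
apply/setP => f; rewrite in_set in_setI in_setU1 in_setI in_set1.
have [->|_] := eqVneq f e; last exact: addbb.
by rewrite eC (negbTE (notin_imset_val F)).
Qed.

Lemma forest_contr F : @forest G' F = forest (e |: val @: F).
Proof.
apply/idP/forestP => [fF f|cutF].
  case/setU1P => [->|/imsetP[h hF ->]]; first exact: forest_contr_cut.
  by have /forestP/(_ h hF)[W /cutset1_contr WF] := fF; exists (pre W).
apply/forestP => f fF; have [|S SF] := cutF (val f).
  by rewrite in_setU1 imset_f ?orbT.
have [|W SW] := @preim_contr_surj _ _ nloop S; last first.
  by exists W; apply/cutset1_contr; rewrite -SW.
apply/eqP; have /setP/(_ e) := SF; rewrite in_setI setU11 andbT in_set1 eq_sym.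
by rewrite (negbTE (valP f)) inE => /negbFE.
Qed.

Lemma spanning_tree_contr F : @spanning_tree G' F = spanning_tree (e |: val @: F).
Proof. by rewrite !spanning_treeE connectsAll_contr forest_contr. Qed.

End ContractedForests.

End Minors.

Section InactiveTreesOfMinors.
Variables (G : graph) (e : gE G) (r : gE G -> nat).
Local Notation E' := {f : gE G | f != e}.
Implicit Types (F : {set E'}) (T : {set gE G}).
Hypothesis r_max : forall f, r f <= r e.

Lemma forall_in_val_max (C : {set gE G}) F (f : E') :
  (forall g : E', (val g \in C) = (g \in F)) ->
  [forall g in C, r (val f) <= r g] = [forall g in F, r (val f) <= r (val g)].
Proof.
move=> CF; apply/forall_inP/forall_inP => min_f g; first by rewrite -CF => /min_f.
have [->|ge] := eqVneq g e; first by rewrite r_max.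
by move=> gC; apply: (min_f (exist _ g ge)); rewrite -CF.
Qed.

Lemma int_active_del F f : @spanning_tree (del e) F -> f \in F ->
  @int_active (del e) (r \o val) F f = int_active r (val @: F) (val f).
Proof.
move=> tF fF; have [S SF] := spanning_tree_cut tF fF.
rewrite (int_activeE _ tF SF) (@int_activeE G _ _ S).
- by rewrite (@forall_in_val_max _ (@cutset (del e) S)) // => g; rewrite !inE.
- by rewrite -spanning_tree_del.
- exact/cutset1_del.
Qed.

Lemma inactive_tree_del F :
  @inactive_tree (del e) (r \o val) F = inactive_tree r (val @: F).
Proof.
rewrite /inactive_tree -spanning_tree_del; have [tF /=|//] := boolP (spanning_tree _).
rewrite forall_in_imset; apply: eq_forallb_in => f fF.
by rewrite int_active_del.
Qed.

Lemma card_inactive_notin :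
  #|[set T | inactive_tree r T & e \notin T]| = @trees_no_int_active (del e) (r \o val).
Proof.
rewrite -[RHS](card_imset _ (imset_inj val_inj)); apply/eq_card => T.
rewrite inE; apply/andP/imsetP => [[tT /imset_val_surj[F TF]]|[F]].
  by exists F; rewrite // inE [_ && _]inactive_tree_del -TF.
by rewrite inE [_ && _]inactive_tree_del => tF ->; rewrite tF notin_imset_val.
Qed.

Section ContractedTrees.
Hypothesis nloop : (gends e).1 != (gends e).2.
Hypothesis r_inj : injective r.
Hypothesis nbr : ~~ is_bridge e.
Local Notation G' := (contr nloop).

Lemma int_active_contr F f : @spanning_tree G' F -> f \in F ->
  @int_active G' (r \o val) F f = int_active r (e |: val @: F) (val f).
Proof.
move=> tF fF; have [W WF] := spanning_tree_cut tF fF.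
rewrite (int_activeE _ tF WF) (@int_activeE _ _ _ (contr_vmap nloop @^-1: W)).
- by rewrite (@forall_in_val_max _ (cutset W)) // => g; rewrite in_cutset_preim.
- by rewrite -spanning_tree_contr.
- exact/cutset1_contr.
Qed.

Lemma inactive_tree_contr F :
  @inactive_tree G' (r \o val) F = inactive_tree r (e |: val @: F).
Proof.
rewrite /inactive_tree -spanning_tree_contr; have [tF /=|//] := boolP (spanning_tree _).
have e_inactive : ~~ int_active r (e |: val @: F) e.
  by apply: max_not_int_active; rewrite ?setU11 // -spanning_tree_contr.
transitivity [forall f in val @: F, ~~ int_active r (e |: val @: F) f].
  by rewrite forall_in_imset; apply: eq_forallb_in => f fF; rewrite int_active_contr.
apply: eq_forallb => f; rewrite in_setU1.
by have [->|//] := eqVneq f e; rewrite e_inactive implybT.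
Qed.

Lemma card_inactive_in :
  #|[set T | inactive_tree r T & e \in T]| = @trees_no_int_active G' (r \o val).
Proof.
have addI : injective (fun F => e |: val @: F).
  move=> F1 F2 /= /(congr1 (fun T => T :\ e)).
  by rewrite !setU1K ?notin_imset_val // => /(imset_inj val_inj).
rewrite -[RHS](card_imset _ addI); apply/eq_card => T.
rewrite inE; apply/andP/imsetP => [[tT eT]|[F]].
  have [F TF] := imset_val_surj (negbT (setD11 e T)).
  by exists F; rewrite ?inE ?[_ && _]inactive_tree_contr -TF setD1K.
by rewrite inE [_ && _]inactive_tree_contr => tF ->; rewrite tF setU11.
Qed.

End ContractedTrees.

Lemma card_inactive_split : trees_no_int_active r =
  #|[set T | inactive_tree r T & e \notin T]| + #|[set T | inactive_tree r T & e \in T]|.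
Proof.
rewrite addnC -[LHS](cardsID [set T : {set gE G} | e \in T]).
by congr (_ + _); apply: eq_card => T; rewrite !inE // andbC.
Qed.

Lemma trees_no_int_active_loop : is_loop e ->
  trees_no_int_active r = @trees_no_int_active (del e) (r \o val).
Proof.
move=> lp; rewrite card_inactive_split card_inactive_notin.
rewrite [X in _ + X]eq_card0 ?addn0 // => T; rewrite inE /inactive_tree spanning_treeE.
by case fT: (forest T); rewrite ?andbF // (negbTE (forest_loop fT lp)) andbF.
Qed.

Lemma trees_no_int_active_del_contr (nloop : (gends e).1 != (gends e).2) :
  injective r -> ~~ is_bridge e ->
  trees_no_int_active r = @trees_no_int_active (del e) (r \o val) +
                          @trees_no_int_active (contr nloop) (r \o val).
Proof.
by move=> r_inj nbr; rewrite card_inactive_split card_inactive_notin card_inactive_in.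
Qed.

End InactiveTreesOfMinors.

Lemma gconnectedP (G : graph) :
  reflect (forall S : {set gV G}, proper_side S -> cutset S != set0) (gconnected G).
Proof.
by apply: (iffP (connectsAllP _)) => conn S /conn; rewrite setIT.
Qed.

Lemma gconnected_del (G : graph) (e : gE G) :
  ~~ is_bridge e -> gconnected G -> gconnected (del e).
Proof.
move=> nbr /gconnectedP conn; apply/gconnectedP => S.
by rewrite [_ == _]cutset_del_eq0 //; apply: conn.
Qed.

Lemma gconnected_contr (G : graph) (e : gE G) (nloop : (gends e).1 != (gends e).2) :
  gconnected G -> gconnected (contr nloop).
Proof.
move=> /gconnectedP conn; apply/gconnectedP => W.
by rewrite -proper_side_preim -cutset_preim_eq0; apply: conn.
Qed.

Lemma edgeless_set0 (G : graph) (F : {set gE G}) : #|gE G| = 0 -> F = set0.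
Proof. by move=> E0; apply/cards0_eq/eqP; rewrite -leqn0 -E0 max_card. Qed.

Lemma trees_no_int_active_edgeless (G : graph) (r : gE G -> nat) :
  gconnected G -> #|gE G| = 0 -> trees_no_int_active r = 1.
Proof.
move=> conn E0; rewrite -(cards1 (set0 : {set gE G})); apply: eq_card => F.
rewrite (edgeless_set0 F E0) [RHS]set11 inE spanning_treeE -(edgeless_set0 setT E0).
rewrite [connectsAll _]conn (edgeless_set0 setT E0).
by apply/andP; split; apply/forall_inP => f; rewrite inE.
Qed.

Lemma alpha_edgeless (G : graph) : #|gE G| = 0 -> alpha G = 1.
Proof.
move=> E0; pose d0 : {ffun gV G -> nat} := [ffun=> 0].
have outdeg0 (eps : orientation G) : outdeg eps = d0.
  by apply/ffunP => v; rewrite !ffunE; apply/eqP; rewrite -leqn0 -E0 max_card.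
rewrite alphaE -(cardfs1 d0); congr #|` _|; apply/fsetP => d; rewrite in_fset1.
apply/imfsetP/eqP => [[eps _ ->]|->] //.
exists ([ffun=> true] : orientation G); rewrite ?outdeg0 //.
by apply/BOP => S _; apply: edgeless_set0.
Qed.

Lemma alpha_trees_no_int_active (G : graph) (r : gE G -> nat) :
  gconnected G -> injective r -> alpha G = trees_no_int_active r.
Proof.
move En: #|gE G| => n; elim: n G r En => [|n IH] G r En conn r_inj.
  by rewrite alpha_edgeless // trees_no_int_active_edgeless.
have /card_gt0P[e0 _] : 0 < #|gE G| by rewrite En.
have [e _ r_max] := @arg_maxnP _ e0 predT r isT.
have {}r_max f : r f <= r e by apply: r_max.
have card_minor : #|gE (del e)| = n by move: En; rewrite (card_del e) => -[].
have r_val_inj : injective (r \o val : gE (del e) -> nat).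
  exact: inj_comp r_inj val_inj.
have [br|nbr] := boolP (is_bridge e).
  by rewrite (alpha_bridge br) (trees_no_int_active_bridge _ br).
have conn_del := gconnected_del nbr conn.
have [lp|nloop] := boolP (is_loop e).
  by rewrite (alpha_loop lp) (trees_no_int_active_loop r_max lp); apply: IH.
rewrite (alpha_del_contr nloop nbr) (trees_no_int_active_del_contr r_max nloop r_inj nbr).
by congr (_ + _); apply: IH => //; apply: gconnected_contr.
Qed.

Lemma tutte_exists (G : graph) : exists T, tutte G T.
Proof.
move En: #|gE G| => n; elim: n G En => [|n IH] G En; first by exists 1%R; constructor.
have /card_gt0P[e _] : 0 < #|gE G| by rewrite En.
have card_minor : #|gE (del e)| = n by move: En; rewrite (card_del e) => -[].
have [p tp] := IH (del e) card_minor.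
have [lp|nloop] := boolP (is_loop e); first by eexists; apply: tutte_loop lp tp.
have [q tq] := IH (contr nloop) card_minor.
have [br|nbr] := boolP (is_bridge e); first by eexists; apply: tutte_bridge br tq.
by eexists; apply: tutte_other nbr tp tq.
Qed.

Lemma alpha_tutte (G : graph) T : tutte G T -> Posz (alpha G) = eval2 T 0%R 1%R.
Proof.
elim=> {G T} [G E0|G e nloop p br _ _|G e p lp _ IH|G e nloop p q nbr _ IHp _ IHq].
- by rewrite alpha_edgeless // /eval2 !hornerE.
- by rewrite (alpha_bridge br) /eval2 /tx hornerM hornerX GRing.mul0r horner0.
- by rewrite (alpha_loop lp) IH /eval2 /ty hornerM hornerC hornerM hornerX GRing.mul1r.
- by rewrite (alpha_del_contr nloop nbr) PoszD IHp IHq /eval2 !hornerD.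
Qed.

Theorem theorem1 (G : graph) :
  gconnected G ->
  (exists T, tutte G T) /\
  (forall T, tutte G T -> Posz (alpha G) = eval2 T 0%R 1%R) /\
  (forall r : gE G -> nat, injective r -> alpha G = trees_no_int_active r).
Proof.
move=> conn; split; first exact: tutte_exists.
by split=> [T|r]; [apply: alpha_tutte | apply: alpha_trees_no_int_active].
Qed.
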